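(* For every fixed integer $r\ge 2$ and real $\epsilon>0$, there exists $C>0$ such that for all positive integers $k,s$ with $C\log k\le s\le k$, we have $$f(k,r,s)\le (r-1+\epsilon)\left(\frac{k^r}{s}\right)^{1/(r-1)}.$$
   Context: An $r$-graph is an $r$-uniform hypergraph. For positive integers $n,k,r,s$ with $r\ge2$ and $s\le k$, an $(n,k,r,s)$-graph is an $r$-graph whose vertex set is partitioned into $n$ disjoint parts of size $k$, such that any $r$ distinct parts induce exactly $s$ edges, each containing exactly one vertex from each of these $r$ parts, and such that these $s$ edges form a matching (are pairwise disjoint). An independent transversal of such a hypergraph is a set containing exactly one vertex from each part and not containing any edge. $f(k,r,s)$ denotes the maximum integer $n$ such that every $(n,k,r,s)$-graph has an independent transversal. $\log$ is the natural logarithm. *)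

(* Defs.v *)
From mathcomp Require Import all_boot.

Set Implicit Arguments.
Unset Strict Implicit.
Unset Printing Implicit Defensive.

(* A hypergraph on the vertex type V is its set of edges E : {set {set V}};
   P is the set of parts of the vertex partition. *)

(* E ::&: cover Q is the set of edges of E induced by the parts in Q. *)
Definition nkrs_graph (n k r s : nat) (V : finType) (P E : {set {set V}}) :
    Prop :=
  [/\ partition P [set: V],
      #|P| = n,
      forall B, B \in P -> #|B| = k,
      forall e, e \in E -> #|e| = r
    & forall Q : {set {set V}}, Q \subset P -> #|Q| = r ->
        [/\ #|E ::&: cover Q| = s,
            forall e B, e \in E ::&: cover Q -> B \in Q -> #|e :&: B| = 1
          & trivIset (E ::&: cover Q)]].

Definition independent_transversal (V : finType) (P E : {set {set V}})
    (T : {set V}) : Prop :=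
  is_transversal T P [set: V] /\ forall e, e \in E -> ~~ (e \subset T).

Definition always_has_IT (n k r s : nat) : Prop :=
  forall (V : finType) (P E : {set {set V}}), nkrs_graph n k r s P E ->
    exists T : {set V}, independent_transversal P E T.

(* is_f k r s n says that f(k, r, s) exists and equals n. *)
Definition is_f (k r s n : nat) : Prop :=
  always_has_IT n k r s /\ forall m, always_has_IT m k r s -> m <= n.

(* Main.v *)
Require Import Defs.
From HB Require Import structures.
From mathcomp Require Import all_boot all_order all_algebra.
From mathcomp Require Import all_classical all_reals all_analysis.
From mathcomp Require Import zify ring lra.
Import mathcomp.boot.fintype mathcomp.boot.finset.
Import Order.TTheory GRing.Theory Num.Theory.
Set Implicit Arguments.
Unset Strict Implicit.
Unset Printing Implicit Defensive.

(** Write L0 = (k^r / s)^(1/(r-1)).  If n > (r - 1 + eps) L0, there is an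
    (n, k, r, s)-graph without an independent transversal, and it comes from a
    colouring of the vertices in which

    - the k vertices of each part get distinct colours;
    - any r parts have at most s colours in common;
    - more than (r - 1) L of the parts use colours from one palette of size L.

    Make every set of r vertices of the same colour in r distinct parts an edge.
    By the second property r parts induce at most s such edges, and by the first
    these are disjoint; as s <= k, they extend greedily to a matching of size s
    ([extend_matching], [colored_graph]).  By the third property and the
    pigeonhole principle, a transversal has r vertices of the same colour, hence
    contains an edge ([no_independent_transversal]).

    The colouring is random: take L slightly larger than (1 + d) L0, where d is
    small compared with eps, let m = (r - 1) L + 1 <= n, and let each of m parts
    use an independent uniform k-subset of the L colours; the other n - m parts
    use private colours.  The number X of colours common to r given parts has
    mean L (k / L)^r <= s / (1 + d), and its probability generating function is
    at most that of a binomial variable,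
      E (1 + x)^X <= (1 + x (k / L)^r)^L,
    because a fixed set of t colours lies in all r subsets with probability at
    most (k / L)^(r t) ([pgf_bigcap]).  Hence X > s has probability at most
    exp (- c s) for some c > 0 depending on eps and r only.  There are at most
    m^r choices of r parts, which is polynomial in k, so s >= C log k with C
    large makes a union bound succeed ([exists_small_intersections],
    [no_IT_above_critical_size]).

    This argument needs k > 1, as log k vanishes at k = 1; for k = 1 we have
    s = 1 and L0 = 1, and a single colour does ([no_IT_singletons]).  Finally
    f(k, r, s) exists, since the numbers n that force an independent transversal
    are bounded and include 0 ([is_f_exists]). *)

(** * Matchings of crossing edges *)

Definition crossing (V : finType) (Q : {set {set V}}) : {set {set V}} :=
  [set e : {set V} | (e \subset cover Q) && [forall B in Q, #|e :&: B| == 1]].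

Lemma crossingP (V : finType) (Q : {set {set V}}) (e : {set V}) :
  reflect (e \subset cover Q /\ {in Q, forall B, #|e :&: B| = 1%N})
          (e \in crossing Q).
Proof.
rewrite inE; apply: (iffP andP) => -[eQ /= eB]; split=> //.
  by move=> B BQ; apply/eqP; move/forall_inP: eB; apply.
by apply/forall_inP => B BQ; rewrite eB.
Qed.

Lemma card_crossing (V : finType) (Q : {set {set V}}) (e : {set V}) :
  trivIset Q -> e \in crossing Q -> #|e| = #|Q|.
Proof.
move=> tQ /crossingP[eQ e1].
rewrite -sum1_card (eq_bigl (fun x => (x \in cover Q) && (x \in e)));
  last first.
  by move=> x; case: (boolP (x \in e)) => [/(subsetP eQ)->|]; rewrite ?andbF.
rewrite big_trivIset_cond //= -sum1_card; apply: eq_bigr => B BQ.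
rewrite sum1dep_card -[RHS](e1 B BQ); apply: eq_card => x.
by rewrite !inE andbC.
Qed.

(** A crossing edge determines the parts it meets.  Thus, in a union of
    matchings chosen separately for each set of parts, the edges induced by [Q]
    are exactly those chosen for [Q]. *)
Lemma crossing_subset (V : finType) (P Q Q' : {set {set V}}) (e : {set V}) :
  trivIset P -> Q \subset P -> Q' \subset P ->
  e \in crossing Q -> e \subset cover Q' -> Q \subset Q'.
Proof.
move=> tP QP QP' /crossingP[_ e1] eQ'; apply/subsetP => B BQ.
have /card_gt0P[x] : (0 < #|e :&: B|)%N by rewrite e1.
rewrite inE => /andP[/(subsetP eQ')/bigcupP[B' BQ' xB'] xB].
suff -> : B = B' by [].
rewrite -(def_pblock tP (subsetP QP _ BQ) xB).
exact: def_pblock tP (subsetP QP' _ BQ') xB'.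
Qed.

(** No part is exhausted by [W], so one free vertex can be picked in each. *)
Lemma exists_crossing_disjoint (V : finType) (Q : {set {set V}}) (W : {set V}) :
  trivIset Q -> {in Q, forall B : {set V}, ~~ (B \subset W)} ->
  exists2 e, e \in crossing Q & [disjoint e & W].
Proof.
move=> tQ QW.
pose e := [set x in cover Q | [pick y in pblock Q x :\: W] == Some x].
exists e.
  apply/crossingP; split; first by apply/subsetP => x; rewrite inE => /andP[].
  move=> B BQ; have /subsetPn[y yB yW] := QW B BQ.
  case Dz: [pick y in B :\: W] => [z|]; last first.
    by case: pickP Dz => // /(_ y); rewrite !inE yB yW.
  have zB : z \in B by case: pickP Dz => // ? + [<-]; rewrite inE => /andP[].
  apply/eqP/cards1P; exists z; apply/setP => x; rewrite !inE.
  apply/idP/eqP => [/andP[/andP[_ +] xB]|->].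
    by rewrite (def_pblock tQ BQ xB) Dz => /eqP[].
  have zQ : z \in cover Q by apply/bigcupP; exists B.
  by rewrite (def_pblock tQ BQ zB) Dz eqxx zB zQ.
rewrite disjoint_subset; apply/subsetP => x; rewrite !inE => /andP[_].
by case: pickP => // z + /eqP[<-]; rewrite !inE => /andP[].
Qed.

Lemma leq_card_bigcup (I T : finType) (A : {pred I}) (F : I -> {set T}) :
  #|\bigcup_(i in A) F i| <= \sum_(i in A) #|F i|.
Proof.
elim/big_rec2: _ => [|i n U _ leUn]; first by rewrite cards0.
by rewrite (leq_trans (leq_card_setU _ _)) ?leq_add2l.
Qed.

(** Greedy extension: a matching with fewer than [k] crossing edges uses fewer
    than [k] vertices of each part, and so leaves room for one more edge. *)
Lemma extend_matching (V : finType) (Q M : {set {set V}}) (k s : nat) :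
  trivIset Q -> (0 < #|Q|)%N -> {in Q, forall B : {set V}, #|B| = k} ->
  M \subset crossing Q -> trivIset M -> (#|M| <= s <= k)%N ->
  exists M' : {set {set V}},
    [/\ M \subset M', M' \subset crossing Q, trivIset M' & #|M'| = s].
Proof.
move=> tQ Q0 Qk; elim: s M => [|s IHs] M MQ tM /andP[].
  by rewrite leqn0 => Ms _; exists M; split=> //; apply/eqP.
rewrite leq_eqVlt ltnS => /orP[/eqP Ms _|Ms sk]; first by exists M.
have [|M' [MM' M'Q tM' M's]] := IHs M MQ tM; first by rewrite Ms ltnW.
have [B BQ|e eQ eM'] := @exists_crossing_disjoint _ Q (cover M') tQ.
  apply/negP => BM'; move: sk; apply/negP; rewrite -leqNgt -(Qk B BQ) -M's.
  have -> : B = \bigcup_(f in M') (f :&: B).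
    by rewrite -big_distrl /=; apply/esym/setIidPr.
  rewrite (leq_trans (leq_card_bigcup _ _))//.
  by rewrite -sum1_card leq_sum // => f /(subsetP M'Q)/crossingP[_ ->].
have e0 : set0 \notin crossing Q.
  apply/negP => /crossingP[_ e1]; have /card_gt0P[B BQ] := Q0.
  by have := e1 B BQ; rewrite set0I cards0.
have [||tU eM] := @trivIsetU1 _ e M' _ tM'.
- by move=> f fM'; apply: disjointWr eM'; apply: bigcup_sup fM'.
- by apply: contra e0 => /(subsetP M'Q).
exists (e |: M'); split=> //.
- exact: subset_trans (subsetUr _ _).
- by rewrite subUset sub1set eQ.
- by rewrite cardsU1 eM M's.
Qed.

(** * Graphs built from vertex colourings *)

Definition monochromatic_crossing (V C : finType) (c : V -> C)
    (Q : {set {set V}}) : {set {set V}} :=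
  [set e in crossing Q | [exists a, [forall x in e, c x == a]]].

(** A colour occurs at most once in each part, so it determines the only
    crossing edge that can carry it; this makes monochromatic edges disjoint
    and at most as numerous as the common colours. *)
Lemma monochromatic_crossing_eq (V C : finType) (c : V -> C)
    (Q : {set {set V}}) (e : {set V}) (a : C) :
  {in Q, forall B : {set V}, {in B &, injective c}} ->
  e \in crossing Q -> {in e, forall x, c x = a} ->
  e = [set x in cover Q | c x == a].
Proof.
move=> cinj /crossingP[eQ e1] ea; apply/setP => x; rewrite !inE.
apply/idP/andP => [xe|[/bigcupP[B BQ xB] /eqP xa]].
  by rewrite (subsetP eQ) // ea.
have /eqP/cards1P[y eBy] := e1 B BQ.
have : y \in e :&: B by rewrite eBy inE.
rewrite inE => /andP[ye yB]; rewrite (cinj B BQ x y xB yB) //.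
by rewrite xa ea.
Qed.

Lemma trivIset_monochromatic_crossing (V C : finType) (c : V -> C)
    (Q : {set {set V}}) :
  {in Q, forall B : {set V}, {in B &, injective c}} ->
  trivIset (monochromatic_crossing c Q).
Proof.
move=> cinj; apply/trivIsetP => e f /setIdP[eQ /existsP[a /forall_inP ea]].
move=> /setIdP[fQ /existsP[b /forall_inP fb]]; apply: contraR.
rewrite -setI_eq0 => /set0Pn[x /setIP[xe xf]].
have ea' : {in e, forall x, c x = a} by move=> y /ea/eqP.
have fa : {in f, forall x, c x = a}.
  by move=> y /fb/eqP->; rewrite -(ea' x xe); apply/esym/eqP/fb.
by rewrite (monochromatic_crossing_eq cinj eQ ea')
  (monochromatic_crossing_eq cinj fQ fa).
Qed.

Lemma card_monochromatic_crossing (V C : finType) (c : V -> C)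
    (Q : {set {set V}}) :
  (0 < #|Q|)%N -> {in Q, forall B : {set V}, {in B &, injective c}} ->
  #|monochromatic_crossing c Q| <= #|\bigcap_(B in Q) (c @: B)|.
Proof.
move=> /card_gt0P[B0 BQ0] cinj.
apply: leq_trans (leq_imset_card (fun a => [set x in cover Q | c x == a]) _).
apply/subset_leq_card/subsetP => e.
case/setIdP => eQ /existsP[a /forall_inP eqa].
have ea : {in e, forall x, c x = a} by move=> x /eqa/eqP.
rewrite (monochromatic_crossing_eq cinj eQ ea); apply: imset_f.
apply/bigcapP => B BQ; have /crossingP[_ e1] := eQ.
have /card_gt0P[x /setIP[xe xB]] : (0 < #|e :&: B|)%N by rewrite e1.
by apply/imsetP; exists x; rewrite ?ea.
Qed.

(** The monochromatic crossing edges of each [r]-set of parts form a matching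
    of size at most [s], which is padded to size exactly [s]; the padding may be
    chosen independently for different [r]-sets. *)
Lemma colored_graph (V C : finType) (P : {set {set V}}) (c : V -> C)
    (n k r s : nat) :
  partition P [set: V] -> #|P| = n ->
  {in P, forall B : {set V}, #|B| = k} -> (0 < r)%N -> (s <= k)%N ->
  {in P, forall B : {set V}, {in B &, injective c}} ->
  (forall Q : {set {set V}}, Q \subset P -> #|Q| = r ->
     #|\bigcap_(B in Q) (c @: B)| <= s) ->
  exists2 E : {set {set V}}, nkrs_graph n k r s P E &
    forall Q : {set {set V}}, Q \subset P -> #|Q| = r ->
      monochromatic_crossing c Q \subset E.
Proof.
move=> partP Pn Pk r0 sk cinj cs; have tP := partition_trivIset partP.
have /fin_all_exists[M MP] : forall Q : {set {set V}}, exists M : {set {set V}},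
    Q \subset P -> #|Q| = r ->
    [/\ monochromatic_crossing c Q \subset M, M \subset crossing Q,
        trivIset M & #|M| = s].
  move=> Q; case: (boolP ((Q \subset P) && (#|Q| == r))); last first.
    by move=> nQ; exists set0 => QP Qr; rewrite QP Qr eqxx in nQ.
  move=> /andP[QP /eqP Qr].
  have cinjQ : {in Q, forall B : {set V}, {in B &, injective c}}.
    by move=> B /(subsetP QP); apply: cinj.
  have [||||||M MP] := @extend_matching _ Q (monochromatic_crossing c Q) k s.
  - exact: trivIsetS tP.
  - by rewrite Qr.
  - by move=> B /(subsetP QP); apply: Pk.
  - by apply/subsetP => e; rewrite inE => /andP[].
  - exact: trivIset_monochromatic_crossing.
  - rewrite sk andbT (leq_trans (card_monochromatic_crossing _ cinjQ)) ?Qr //.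
    exact: cs.
  by exists M.
pose E := \bigcup_(Q : {set {set V}} | (Q \subset P) && (#|Q| == r)) M Q.
have EM (Q : {set {set V}}) : Q \subset P -> #|Q| = r -> E ::&: cover Q = M Q.
  move=> QP Qr; have [_ MQ _ _] := MP Q QP Qr; apply/setP => e; rewrite !inE.
  apply/andP/idP => [[/bigcupP[Q' /andP[QP' /eqP Qr'] eM] eQ]|eM]; last first.
    split; first by apply/bigcupP; exists Q; rewrite ?QP ?Qr /=.
    by have /(subsetP MQ)/crossingP[] := eM.
  have [_ /subsetP/(_ _ eM) eQ' _ _] := MP Q' QP' Qr'.
  have /eqP <- // : Q' == Q.
  by rewrite eqEcard (crossing_subset tP _ _ eQ' eQ) // Qr Qr' /=.
exists E; last first.
  move=> Q QP Qr; have [cM _ _ _] := MP Q QP Qr.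
  apply: subset_trans cM _; rewrite -EM //.
  by apply/subsetP => e; rewrite inE => /andP[].
split=> //.
- move=> e /bigcupP[Q /andP[QP /eqP Qr] eM].
  have [_ /subsetP/(_ _ eM) eQ _ _] := MP Q QP Qr.
  by rewrite -Qr; apply: card_crossing eQ; apply: trivIsetS tP.
- move=> Q QP Qr; rewrite EM //; have [_ /subsetP MQ tM Ms] := MP Q QP Qr.
  by split=> // e B /MQ/crossingP[_]; apply.
Qed.

Lemma pigeonhole_color (V C : finType) (c : V -> C) (D : {set C}) (T : {set V})
    (m : nat) :
  {in T, forall x, c x \in D} -> (m * #|D| < #|T|)%N ->
  exists (a : C) (e : {set V}),
    [/\ e \subset T, #|e| = m.+1 & {in e, forall x, c x = a}].
Proof.
move=> TD mDT.
have [a aD ma] : exists2 a, a \in D & (m < #|[set x in T | c x == a]|)%N.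
  apply/exists_inP; apply: contraLR mDT.
  rewrite negb_exists_in => /forall_inP ma.
  rewrite -leqNgt -sum1_card (partition_big c (mem D)) //= mulnC -sum_nat_const.
  apply: leq_sum => a /ma; rewrite -leqNgt; apply: leq_trans.
  by rewrite sum1dep_card; apply/subset_leq_card/subsetP => x; rewrite !inE.
have : (0 < #|[set e : {set V} |
                 e \subset [set x in T | c x == a] & #|e| == m.+1]|)%N.
  by rewrite cards_draws bin_gt0.
move=> /card_gt0P[e]; rewrite inE => /andP[/subsetP ea /eqP em].
exists a, e; split=> // [|x /ea]; last by rewrite inE => /andP[_ /eqP].
by apply/subsetP => x /ea; rewrite inE => /andP[].
Qed.

Lemma transversal_crossing (V : finType) (P : {set {set V}}) (T e : {set V}) :
  is_transversal T P [set: V] -> e \subset T ->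
  [/\ pblock P @: e \subset P, #|pblock P @: e| = #|e| &
      e \in crossing (pblock P @: e)].
Proof.
move=> Ttr eT; have /and3P[partP _ /forall_inP T1] := Ttr.
have xP x : x \in cover P by rewrite (cover_partition partP) inE.
have eP : pblock P @: e \subset P.
  by apply/subsetP => B /imsetP[x _ ->]; rewrite pblock_mem.
split=> //.
  apply: card_in_imset => x y /(subsetP eT) xT /(subsetP eT).
  exact: (pblock_inj Ttr).
apply/crossingP; split.
  apply/subsetP => x xe; apply/bigcupP.
  exists (pblock P x); first exact: imset_f.
  by rewrite mem_pblock.
move=> B Be; apply/eqP; rewrite eqn_leq; apply/andP; split.
  rewrite -(eqP (T1 B (subsetP eP _ Be))); apply/subset_leq_card.
  exact: setSI.
have /imsetP[x xe ->] := Be; apply/card_gt0P; exists x.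
by rewrite inE xe mem_pblock xP.
Qed.

(** Only the parts in [P0] need to be coloured economically: a transversal meets
    [P0] in more than [m * #|D|] vertices with colours in [D], hence repeats a
    colour [m.+1] times. *)
Lemma no_independent_transversal (V C : finType) (P P0 E : {set {set V}})
    (c : V -> C) (D : {set C}) (m : nat) :
  P0 \subset P -> {in cover P0, forall x, c x \in D} -> (m * #|D| < #|P0|)%N ->
  (forall Q : {set {set V}}, Q \subset P -> #|Q| = m.+1 ->
      monochromatic_crossing c Q \subset E) ->
  forall T, ~ independent_transversal P E T.
Proof.
move=> P0P cD mD monoE T [Ttr Tind]; have /and3P[partP _ /forall_inP T1] := Ttr.
have [||a [e [eT em ea]]] := @pigeonhole_color _ _ c D (T :&: cover P0) m.
- by move=> x /setIP[_]; apply: cD.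
- rewrite (@card_crossing _ P0) //.
    exact: trivIsetS (partition_trivIset partP).
  apply/crossingP; split=> [|B BP0]; first exact: subsetIr.
  have BcP0 : B \subset cover P0 by apply: bigcup_sup BP0.
  by rewrite -setIA (setIidPr BcP0); apply/eqP/T1/(subsetP P0P).
have {}eT : e \subset T by apply: subset_trans eT (subsetIl _ _).
have [eP ecard eQ] := transversal_crossing Ttr eT.
suff /Tind : e \in E by rewrite eT.
apply: (subsetP (monoE _ eP (etrans ecard em))).
by rewrite inE eQ; apply/existsP; exists a; apply/forall_inP => x /ea ->.
Qed.

(** * From set families to graphs *)

Lemma set_enumeration (C : finType) (S : {set C}) (k : nat) :
  #|S| = k -> exists2 f : 'I_k -> C, injective f & f @: 'I_k = S.
Proof.
move=> <-; exists enum_val; first exact: enum_val_inj.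
apply/setP => x; apply/imsetP/idP => [[i _ ->]|xS]; first exact: enum_valP.
by exists (enum_rank_in xS x); rewrite ?enum_rankK_in.
Qed.

Section Columns.
Variables (J : finType) (k : nat).

Definition column (i : J) : {set J * 'I_k} := [set x | x.1 == i].

Lemma column_image i : column i = pair i @: 'I_k.
Proof.
apply/setP => -[i' j]; rewrite inE /=; apply/eqP/imsetP => [->|[j' _ [-> _]]//].
by exists j.
Qed.

Lemma card_column i : #|column i| = k.
Proof. by rewrite column_image card_imset ?card_ord // => x y []. Qed.

Hypothesis k_gt0 : 0 < k.

Lemma column_inj : injective column.
Proof.
move=> i i' /setP/(_ (i, Ordinal k_gt0)); rewrite !inE /= eqxx => /esym/eqP.
by [].
Qed.

Lemma partition_columns : partition (column @: J) [set: J * 'I_k].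
Proof.
apply/and3P; split.
- rewrite eqEsubset subsetT; apply/subsetP => x _; apply/bigcupP.
  by exists (column x.1); rewrite ?imset_f // inE.
- apply/trivIsetP => _ _ /imsetP[i _ ->] /imsetP[i' _ ->]; apply: contraR.
  rewrite -setI_eq0 => /set0Pn[x]; rewrite !inE => /andP[/eqP <- /eqP <-].
  by [].
- apply/imsetP => -[i _ /esym/eqP]; apply/negP/set0Pn.
  by exists (i, Ordinal k_gt0); rewrite inE /=.
Qed.
End Columns.

(** A set system [S] with small [r.+2]-wise intersections colours the parts
    indexed by [I]: the vertices of part [i] receive the elements of [S i].  The
    remaining parts, needed only to reach [n] parts, give every vertex a private
    colour, so they share no colour with any other part. *)
Lemma set_family_no_IT (I C : finType) (S : I -> {set C}) (k r s n : nat) :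
  0 < k -> s <= k -> (forall i, #|S i| = k) ->
  (forall A : {set I}, #|A| = r.+2 -> #|\bigcap_(i in A) S i| <= s) ->
  r.+1 * #|C| < #|I| -> #|I| <= n -> ~ always_has_IT n k r.+2 s.
Proof.
move=> k0 sk Sk Ss CI In.
pose J : finType := (I + 'I_(n - #|I|))%type.
pose V : finType := (J * 'I_k)%type.
have /fin_all_exists[f fP] : forall i : I, exists f : 'I_k -> C,
    injective f /\ f @: 'I_k = S i.
  by move=> i; have [f f_inj fS] := set_enumeration (Sk i); exists f.
pose c (x : V) : C + V := if x.1 is inl i then inl (f i x.2) else inr x.
pose P : {set {set V}} := @column J k @: J.
have partP : partition P [set: V] by apply: partition_columns.
have cinj : {in P, forall B : {set V}, {in B &, injective c}}.
  move=> _ /imsetP[i _ ->] [i1 j1] [i2 j2]; rewrite !inE /= => /eqP-> /eqP->.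
  case: i => [i|d]; rewrite /c /=; last by move=> [->].
  by move=> [/(fP i).1 ->].
have cS i : c @: column k (inl i) = inl @: S i.
  rewrite column_image -imset_comp -(fP i).2 -imset_comp.
  by apply: eq_imset.
have cI : forall Q : {set {set V}}, Q \subset P -> #|Q| = r.+2 ->
    #|\bigcap_(B in Q) (c @: B)| <= s.
  move=> Q QP Qr.
  (* A part with private colours has no colour in common with another part. *)
  have [|] := boolP [exists d, column k (inr d) \in Q].
    case/existsP => d dQ.
    have [B BQ Bd] : exists2 B, B \in Q & B != column k (inr d).
      have : 0 < #|Q :\ column k (inr d)|.
        by move: Qr; rewrite (cardsD1 (column k (inr d))) dQ add1n => -[->].
      by case/card_gt0P => B; rewrite !inE => /andP[Bd BQ]; exists B.
    rewrite (_ : \bigcap_(B in Q) _ = set0) ?cards0 //.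
    apply/setP => a; rewrite inE; apply/negP => /bigcapP aQ.
    have /imsetP[[y j]] := aQ _ dQ; rewrite inE /= => /eqP-> {y} aE.
    have /imsetP[[y j'] yB] := aQ _ BQ; rewrite aE /c /=.
    case: y yB => [//|d' d'B [dd' _]]; subst d'; move/negP: Bd; apply.
    have /imsetP[i _ Bi] := subsetP QP _ BQ; move: d'B; rewrite Bi inE /=.
    by move/eqP=> <-.
  rewrite negb_exists => /forallP noQ.
  pose A := [set i : I | column k (inl i) \in Q].
  have QA : Q = [set column k (inl i) | i in A].
    apply/setP => B; apply/idP/imsetP => [BQ|[i]]; last by rewrite inE => iA ->.
    have /imsetP[[i|d] _ Bi] := subsetP QP _ BQ.
      by exists i; rewrite // inE -Bi.
    by have := noQ d; rewrite -Bi BQ.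
  have Ar : #|A| = r.+2.
    by rewrite -Qr QA card_imset // => i i' /(column_inj k0)[].
  apply: leq_trans (Ss A Ar).
  apply: leq_trans (leq_imset_card (inl : C -> C + V) _).
  apply/subset_leq_card/subsetP => a /bigcapP aQ.
  have /card_gt0P[i0 i0A] : 0 < #|A| by rewrite Ar.
  have := aQ _ _; rewrite QA => /(_ _ (imset_f _ i0A)).
  rewrite cS => /imsetP[b _ ab]; rewrite ab imset_f //.
  apply/bigcapP => i iA.
  have := aQ _ _; rewrite QA => /(_ _ (imset_f _ iA)).
  by rewrite cS ab => /imsetP[b' b'S [->]].
have Pn : #|P| = n.
  by rewrite card_imset ?card_sum ?card_ord ?subnKC //; apply: column_inj.
have [|E graphE monoE] := colored_graph partP Pn _ (ltn0Sn r.+1) sk cinj cI.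
  by move=> _ /imsetP[i _ ->]; apply: card_column.
move=> /(_ _ _ _ graphE)[T].
pose P0 := [set column k (inl i : J) | i : I].
pose D : {set C + V} := [set inl b | b : C].
apply: (@no_independent_transversal _ _ _ P0 _ _ D) monoE T.
- by apply/subsetP => _ /imsetP[i _ ->]; apply: imset_f.
- move=> x /bigcupP[_ /imsetP[i _ ->]]; rewrite inE /c => /eqP ->.
  exact: imset_f.
- rewrite !card_imset //; last by move=> ? ? [].
  by move=> i i' /(column_inj k0)[].
Qed.

(** * Random set families *)

Local Open Scope ring_scope.

Lemma card_supersets (C : finType) (A : {set C}) (k : nat) : (#|A| <= k)%N ->
  #|[set S : {set C} | A \subset S & #|S| == k]| = 'C(#|C| - #|A|, k - #|A|).
Proof.
move=> Ak; have -> : (#|C| - #|A| = #|~: A|)%N by rewrite -(cardsC A) addKn.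
rewrite -cards_draws.
rewrite -[RHS](card_in_imset (f := fun B => A :|: B)); last first.
  move=> B B' /[!inE] /andP[BA _] /andP[BA' _] /setP AB; apply/setP => x.
  have := AB x; rewrite !inE; case: (boolP (x \in A)) => // xA _.
  by apply/idP/idP => [/(subsetP BA)|/(subsetP BA')]; rewrite inE xA.
apply: eq_card => S; rewrite inE; apply/andP/imsetP => [[AS /eqP Sk]|[B]].
  exists (S :\: A); last by rewrite -{1}(setID S A) (setIidPr AS).
  by rewrite inE setDE subsetIr /= -setDE cardsD (setIidPr AS) Sk.
rewrite inE => /andP[BA /eqP Bk] ->; rewrite subsetUl cardsU.
have -> : A :&: B = set0.
  by apply/eqP; rewrite setI_eq0 disjoint_sym disjoints_subset.
by rewrite cards0 subn0 Bk subnKC.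
Qed.

(** Divided by ['C(L, k) * L ^ t], this bounds by [(k / L) ^ t] the probability
    that a uniform [k]-subset of an [L]-set contains [t] given elements: each
    further element is contained with probability
    [(k - t) / (L - t) <= k / L]. *)
Lemma bin_sub_expn (L k t : nat) : (t <= k <= L)%N ->
  ('C(L - t, k - t) * L ^ t <= 'C(L, k) * k ^ t)%N.
Proof.
elim: t => [|t IHt] /andP[tk kL]; first by rewrite !subn0 !expn0.
have {}IHt := IHt (introT andP (conj (ltnW tk) kL)).
have Lt : (0 < L - t)%N by lia.
rewrite -(leq_pmul2l Lt) mulnA.
have -> : ((L - t) * 'C(L - t.+1, k - t.+1) = (k - t) * 'C(L - t, k - t))%N.
  have -> : (L - t.+1 = (L - t).-1)%N by lia.
  by rewrite mul_bin_diag; congr (_ * 'C(_, _))%N; lia.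
have h : ((k - t) * L <= (L - t) * k)%N by nia.
rewrite !expnSr.
have := leq_mul IHt h; lia.
Qed.

Section Counting.
Variables (R : realFieldType) (C : finType).

Lemma sum_subsets_expr (x : R) (X : {set C}) :
  \sum_(A : {set C} | A \subset X) x ^+ #|A| = (1 + x) ^+ #|X|.
Proof.
pose F a : R := if a \in X then x else 0.
have -> : (1 + x) ^+ #|X| = \prod_a (F a + 1).
  rewrite (bigID (mem X)) /= -prodr_const [X in _ = _ * X]big1 ?mulr1.
    by apply: eq_bigr => a aX; rewrite /F aX addrC.
  by move=> a /negbTE aX; rewrite /F aX add0r.
rewrite bigA_distr big_mkcond /=; apply: eq_bigr => A _.
rewrite -big_mkcond /= /F; case: ifPn.
  move=> /subsetP AX.
  by rewrite -prodr_const; apply: eq_bigr => a /AX ->.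
by move=> /subsetPn[a aA /negbTE aX]; rewrite (bigD1 a) //= aX mul0r.
Qed.

Lemma card_supersets_le (A : {set C}) (k : nat) : (k <= #|C|)%N ->
  #|[set S : {set C} | A \subset S & #|S| == k]|%:R <=
  'C(#|C|, k)%:R * (k%:R / #|C|%:R) ^+ #|A| :> R.
Proof.
move=> kC; have [Ak|kA] := leqP #|A| k; last first.
  rewrite (_ : [set _ | _] = set0) ?cards0 ?mulr_ge0 ?exprn_ge0 ?divr_ge0 //.
  apply/setP => S; rewrite !inE.
  apply/negP => /andP[/subset_leq_card + /eqP Sk].
  by rewrite Sk leqNgt kA.
rewrite card_supersets //; have [C0|C0] := posnP #|C|.
  have k0 : k = 0%N by apply/eqP; rewrite -leqn0 -C0.
  have A0 : #|A| = 0%N by apply/eqP; rewrite -leqn0 -k0.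
  by rewrite A0 !subn0 expr0 mulr1.
rewrite expr_div_n mulrA ler_pdivlMr ?exprn_gt0 ?ltr0n //.
by rewrite -!natrX -!natrM ler_nat bin_sub_expn ?Ak.
Qed.

(** Up to the factor ['C(#|C|, k) ^+ #|I|], the left-hand side is the
    probability generating function, at [1 + x], of the size of the
    intersection of [#|Q|] independent uniform [k]-subsets of [C].  Expanding
    [(1 + x) ^+ #|X|] over the subsets [A] of the intersection [X] reduces it to
    the events that all these [k]-subsets contain [A], whose probabilities
    factor over [Q]. *)
Lemma pgf_bigcap (I : finType) (Q : {set I}) (k : nat) (x : R) :
  0 <= x -> (k <= #|C|)%N ->
  \sum_(f in ffun_on [pred S : {set C} | #|S| == k])
    (1 + x) ^+ #|\bigcap_(i in Q) f i| <=
  'C(#|C|, k)%:R ^+ #|I| * (1 + x * (k%:R / #|C|%:R) ^+ #|Q|) ^+ #|C|.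
Proof.
move=> x0 kC.
pose F (A : {set C}) (i : I) (S : {set C}) : R :=
  ((i \in Q) ==> (A \subset S))%:R.
have expand (f : {ffun I -> {set C}}) :
    (1 + x) ^+ #|\bigcap_(i in Q) f i| =
    \sum_(A : {set C}) x ^+ #|A| * \prod_i F A i (f i).
  rewrite -sum_subsets_expr big_mkcond; apply: eq_bigr => A _ /=.
  case: bigcapsP => [AQ|nAQ].
    rewrite big1 ?mulr1 // => i _; rewrite /F.
    by case: (boolP (i \in Q)) => //= /AQ ->.
  have : ~~ [forall i in Q, A \subset f i] by apply/forall_inP.
  rewrite negb_forall_in => /exists_inP[i iQ Ai].
  by rewrite (bigD1 i) //= /F iQ (negbTE Ai) mul0r mulr0.
under eq_bigr do rewrite expand.
rewrite exchange_big /=.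
have -> : (1 + x * (k%:R / #|C|%:R) ^+ #|Q|) ^+ #|C| =
    \sum_(A : {set C}) (x * (k%:R / #|C|%:R) ^+ #|Q|) ^+ #|A| :> R.
  rewrite -cardsT -sum_subsets_expr; apply: eq_bigl => A.
  by rewrite subsetT.
rewrite mulr_sumr; apply: ler_sum => A _.
rewrite -mulr_sumr -(bigA_distr_big _ (F A)).
rewrite exprMn mulrCA ler_wpM2l ?exprn_ge0 // -exprM mulnC exprM.
have -> : 'C(#|C|, k)%:R ^+ #|I| * ((k%:R / #|C|%:R) ^+ #|A|) ^+ #|Q| =
    \prod_(i : I) (if i \in Q then 'C(#|C|, k)%:R * (k%:R / #|C|%:R) ^+ #|A|
                   else 'C(#|C|, k)%:R) :> R.
  rewrite -[_ ^+ #|Q|]prodr_const [X in _ * X]big_mkcond /=.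
  have -> : 'C(#|C|, k)%:R ^+ #|I| = \prod_(i : I) 'C(#|C|, k)%:R :> R.
    by rewrite prodr_const.
  rewrite -big_split /=.
  by apply: eq_bigr => i _; case: ifP; rewrite ?mulr1.
apply: ler_prod => i _; rewrite sumr_ge0 //= /F.
case: (boolP (i \in Q)) => /= _; last first.
  by rewrite sumr_const -card_draws cardsE.
apply: le_trans (card_supersets_le A kC).
rewrite -sum1_card natr_sum big_mkcond [leRHS]big_mkcond /= le_eqVlt.
apply/orP; left; apply/eqP; apply: eq_bigr => S _; rewrite !inE andbC.
by case: (#|S| == k) => //=; case: (A \subset S).
Qed.

(** The union bound over the [r]-subsets of [I], with Markov's inequality for
    [(1 + x) ^+ X], where [X] is the size of the intersection. *)
Lemma exists_small_intersections (I : finType) (k r s : nat) (x : R) :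
  0 <= x -> (k <= #|C|)%N ->
  'C(#|I|, r)%:R * (1 + x * (k%:R / #|C|%:R) ^+ r) ^+ #|C| < (1 + x) ^+ s.+1 ->
  exists S : I -> {set C}, (forall i, #|S i| = k) /\
    forall A : {set I}, #|A| = r -> (#|\bigcap_(i in A) S i| <= s)%N.
Proof.
move=> x0 kC small.
pose K := [pred S : {set C} | #|S| == k]; pose N : R := 'C(#|C|, k)%:R ^+ #|I|.
pose large (f : {ffun I -> {set C}}) (A : {set I}) :=
  (s < #|\bigcap_(i in A) f i|)%N.
have [/exists_inP[f fK fs]|] := boolP
    [exists f in @ffun_on I K,
       [forall A : {set I}, (#|A| == r) ==> ~~ large f A]].
  exists f; split=> [i|A /eqP Ar].
    by apply/eqP; move/ffun_onP: fK => /(_ i).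
  by move/forallP: fs => /(_ A); rewrite Ar /= -leqNgt.
rewrite negb_exists_in => /forall_inP bad.
suff : N * (1 + x) ^+ s.+1 <=
    N * ('C(#|I|, r)%:R * (1 + x * (k%:R / #|C|%:R) ^+ r) ^+ #|C|).
  rewrite ler_pM2l; first by move/(lt_le_trans small); rewrite ltxx.
  by rewrite exprn_gt0 // ltr0n bin_gt0.
have -> : N * (1 + x) ^+ s.+1 =
    \sum_(f in @ffun_on I K) (1 + x) ^+ s.+1.
  rewrite sumr_const card_ffun_on -mulr_natl natrX.
  by rewrite /N -card_draws cardsE.
apply: (@le_trans _ _ (\sum_(A : {set I} | #|A| == r)
    \sum_(f in @ffun_on I K) (1 + x) ^+ #|\bigcap_(i in A) f i|)).
  rewrite exchange_big /=; apply: ler_sum => f /bad.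
  rewrite negb_forall => /existsP[A].
  rewrite negb_imply negbK => /andP[Ar As].
  rewrite (bigD1 A) //= ler_wpDr ?sumr_ge0 //.
    by move=> B _; rewrite exprn_ge0 // addr_ge0.
  by rewrite ler_weXn2l // lerDl.
rewrite mulrCA -[in leRHS](card_draws I r) -sum1_card natr_sum mulr_suml.
under [leRHS]eq_bigl do rewrite inE.
by apply: ler_sum => A /eqP Ar; rewrite mul1r -Ar pgf_bigcap.
Qed.

End Counting.

(** * Existence of f(k, r, s) *)

Lemma always_has_IT0 (k r s : nat) : (0 < r)%N -> always_has_IT 0 k r s.
Proof.
move=> r0 V P E [partP /eqP + _ Er _]; rewrite cards_eq0 => /eqP P0.
have V0 : [set: V] = set0.
  by rewrite -(cover_partition partP) P0 /cover big_set0.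
exists set0; split.
  rewrite /is_transversal partP sub0set P0.
  by apply/forall_inP => B; rewrite inE.
move=> e /Er er; apply/negP; rewrite subset0 => /eqP e0.
by rewrite -er e0 cards0 in r0.
Qed.

Lemma is_f_exists (R : realType) (k r s : nat) (b : R) : (0 < r)%N ->
  (forall n : nat, b < n%:R -> ~ always_has_IT n k r s) ->
  exists n : nat, is_f k r s n /\ n%:R <= b.
Proof.
move=> r0 noIT.
have le_b n : always_has_IT n k r s -> n%:R <= b.
  by rewrite leNgt => IT; apply/negP => /noIT.
pose p n := `[< always_has_IT n k r s >].
have p_ex : exists n, p n by exists 0%N; apply/asboolP/always_has_IT0.
have p_le n : p n -> (n <= Num.truncn b)%N.
  move/asboolP => /le_b nb; rewrite truncn_ge_nat //.
  exact: le_trans nb.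
case: (ex_maxnP p_ex p_le) => n /asboolP nIT nmax.
exists n; split; last exact: le_b.
by split=> // m /asboolP; apply: nmax.
Qed.

(** * Estimates *)

Lemma bin_le_expn (n m : nat) : ('C(n, m) <= n ^ m)%N.
Proof.
apply: (@leq_trans (n ^_ m)); first by rewrite -bin_ffact leq_pmulr ?fact_gt0.
elim: m n => [|m IHm] [|n] //; rewrite ffactSS expnS leq_mul2l /=.
by apply: leq_trans (IHm _) _; case: m {IHm} => // m; rewrite leq_exp2r.
Qed.

Section Estimates.
Variable R : realType.
Implicit Types x d y B : R.

Lemma expR_le_1Dx x : 0 <= x -> expR (x / (1 + x)) <= 1 + x.
Proof.
move=> x0; have x1 : 0 < 1 + x by lra.
have := expR_ge1Dx (- (x / (1 + x))).
have -> : 1 + - (x / (1 + x)) = (1 + x)^-1 by field; lra.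
by rewrite expRN lef_pV2 // ?posrE // expR_gt0.
Qed.

(** The union bound succeeds when the mean [L%:R * y] is at most [s / (1 + d)]
    and the number [B] of events is at most the exponential of the difference
    between [s * ln (1 + x) >= s * x / (1 + x)] and
    [L * ln (1 + x * y) <= s * x / (1 + d)]. *)
Lemma moment_bound x d y B (L s : nat) :
  0 < x -> 0 < d -> 0 <= y -> L%:R * y <= s%:R / (1 + d) -> 0 <= B ->
  B <= expR ((x / (1 + x) - x / (1 + d)) * s%:R) ->
  B * (1 + x * y) ^+ L < (1 + x) ^+ s.+1.
Proof.
move=> x0 d0 y0 Ly B0 BB.
have h1 : (1 + x * y) ^+ L <= expR (x / (1 + d) * s%:R).
  apply: (@le_trans _ _ (expR (x * y) ^+ L)).
    have xy : 0 <= x * y by rewrite mulr_ge0 // ltW.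
    by apply: lerXn2r; rewrite ?nnegrE ?expR_ge0 ?expR_ge1Dx //; lra.
  rewrite -expRM_natl ler_expR.
  have := ler_wpM2l (ltW x0) Ly; lra.
have h2 : expR (x / (1 + x) * s%:R) <= (1 + x) ^+ s.
  rewrite mulrC expRM_natl.
  by apply: lerXn2r; rewrite ?nnegrE ?expR_ge0 ?expR_le_1Dx //; lra.
apply: (@le_lt_trans _ _ ((1 + x) ^+ s)).
  apply: le_trans h2.
  have -> : x / (1 + x) * s%:R =
    (x / (1 + x) - x / (1 + d)) * s%:R + x / (1 + d) * s%:R by ring.
  rewrite expRD ler_pM // exprn_ge0 // addr_ge0 // mulr_ge0 //.
  exact: ltW.
by rewrite exprS ltr_pMl ?exprn_gt0 //; lra.
Qed.

Lemma ln2_ge : 2^-1 <= ln 2 :> R.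
Proof.
rewrite -ler_expR lnK ?posrE //.
have := expR_ge1Dx (- 2^-1 : R); rewrite expRN => h.
rewrite -lef_pV2 ?posrE ?expR_gt0 //; lra.
Qed.

Definition critical_size (r k s : nat) : R :=
  (k%:R ^+ r / s%:R) `^ (r%:R - 1)^-1.

Lemma critical_size_exp (r k s : nat) :
  critical_size r.+2 k s ^+ r.+1 = k%:R ^+ r.+2 / s%:R.
Proof.
have q0 : (r.+2%:R - 1 : R) = r.+1%:R by rewrite -natr1; lra.
rewrite /critical_size q0 -powR_mulrn ?powR_ge0 // -powRrM mulVf ?pnatr_eq0 //.
by rewrite powRr1 // divr_ge0 ?exprn_ge0.
Qed.

Lemma critical_size_ge (r k s : nat) : (0 < s <= k)%N ->
  k%:R <= critical_size r.+2 k s.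
Proof.
move=> /andP[s0 sk].
rewrite -(@ler_pXn2r _ r.+1) ?nnegrE ?powR_ge0 // critical_size_exp.
rewrite ler_pdivlMr ?ltr0n // [leRHS]exprSr ler_wpM2l ?exprn_ge0 //.
by rewrite ler_nat.
Qed.

Lemma critical_size_le (r k s : nat) : (0 < s)%N -> (0 < k)%N ->
  critical_size r.+2 k s <= k%:R ^+ 2.
Proof.
move=> s0 k0.
rewrite -(@ler_pXn2r _ r.+1) ?nnegrE ?powR_ge0 ?exprn_ge0 // critical_size_exp.
apply: (@le_trans _ _ (k%:R ^+ r.+2)).
  by rewrite ler_pdivrMr ?ltr0n // ler_peMr ?exprn_ge0 // ler1n.
by rewrite -exprM ler_weXn2l ?ler1n // ?ler1n //; lia.
Qed.

Lemma critical_size1 (r : nat) : critical_size r 1 1 = 1.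
Proof. by rewrite /critical_size expr1n divr1 powR1. Qed.

End Estimates.

(** * The critical size is an upper bound *)

Lemma no_IT_singletons (r n : nat) :
  (r.+2 <= n)%N -> ~ always_has_IT n 1 r.+2 1.
Proof.
move=> rn; apply: (@set_family_no_IT 'I_r.+2 unit (fun=> [set: unit])) => //.
- by move=> _; rewrite cardsT card_unit.
- by move=> A _; rewrite -[leqRHS]card_unit max_card.
- by rewrite card_unit card_ord muln1.
- by rewrite card_ord.
Qed.

Section Threshold.
Variables (R : realType) (r : nat) (eps : R).
Hypothesis eps_gt0 : 0 < eps.

(* [d] is the relative surplus of colours over the critical size; it costs half
   of [eps], the other half absorbing the rounding of the number of colours.
   Any [x < d] makes the exponential decay [rate] positive.  The number [a] is
   such that [2 ^ a], hence [k ^ a], is at least the constant factor in the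
   bound on the number of parts. *)
Let d : R := eps / (2 * r.+1%:R).
Let x : R := d / 2.
Let rate : R := x / (1 + x) - x / (1 + d).
Let a : nat := (Num.truncn (r.+2%:R * (2 + d))).+1.

(** The first term makes [k >= s] so large that rounding the number of colours
    costs at most [eps / 2]; the second makes [exp (rate * s)] at
    least [(k ^ (a + 2)) ^ r.+2], a bound on the number of [r.+2]-sets of
    parts. *)
Definition threshold : R :=
  4 * r.+1%:R / eps + (a + 2)%:R * r.+2%:R / rate.

Let r1_gt0 : 0 < r.+1%:R :> R. Proof. by rewrite ltr0n. Qed.

Let d_gt0 : 0 < d. Proof. by rewrite divr_gt0 // mulr_gt0. Qed.

Let x_gt0 : 0 < x. Proof. by rewrite divr_gt0. Qed.

Let rate_gt0 : 0 < rate.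
Proof.
rewrite subr_gt0 ltr_pM2l // ltf_pV2 ?posrE /x; have := d_gt0; lra.
Qed.

Lemma threshold_gt0 : 0 < threshold.
Proof.
by rewrite ltr_pwDl ?mulr_ge0 ?invr_ge0 ?ltW // divr_gt0 // mulr_gt0.
Qed.

Let two_expn : r.+2%:R * (2 + d) <= 2 ^+ a.
Proof.
apply: (@le_trans _ _ a%:R); first exact/ltW/truncnS_gt.
by rewrite -natrX ler_nat ltnW // ltn_expl.
Qed.

(** With [L] just above [(1 + d) * L0] colours and [m = r.+1 * L + 1] parts
    coloured at random, the surplus [d] keeps the expected number of common
    colours below [s / (1 + d)], while [m <= n] still holds. *)
Lemma no_IT_above_critical_size (k s n : nat) : (1 < k)%N -> (0 < s <= k)%N ->
  threshold * ln k%:R <= s%:R ->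
  (r.+1%:R + eps) * critical_size R r.+2 k s < n%:R ->
  ~ always_has_IT n k r.+2 s.
Proof.
move=> k1 /andP[s0 sk] ths nL; set L0 := critical_size _ _ _ _ in nL.
have k0 : (0 < k)%N := ltnW k1.
have kL0 : k%:R <= L0 by apply: critical_size_ge; rewrite s0.
have L0k : L0 <= k%:R ^+ 2 by apply: critical_size_le.
have L0_gt0 : 0 < L0 by apply: lt_le_trans kL0; rewrite ltr0n.
pose L := (Num.truncn ((1 + d) * L0)).+1.
have dL0 : 0 <= (1 + d) * L0 by rewrite mulr_ge0 ?ltW //; have := d_gt0; lra.
have L_gt : (1 + d) * L0 < L%:R := truncnS_gt _.
have L_le : L%:R <= (1 + d) * L0 + 1.
  by rewrite -natr1 lerD2r truncn_le.
have kL : (k <= L)%N.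
  rewrite -(ler_nat R); apply: le_trans kL0 _; apply: ltW.
  apply: le_lt_trans L_gt; rewrite ler_peMl ?ltW //; have := d_gt0; lra.
have lnk : ln 2 <= ln k%:R :> R by rewrite ler_ln ?posrE ?ltr0n // ler_nat.
have lnk_ge : 2^-1 <= ln k%:R :> R := le_trans (ln2_ge R) lnk.
have ths1 : 4 * r.+1%:R / eps * ln k%:R <= s%:R.
  apply: le_trans ths; rewrite ler_pM2r; last lra.
  by rewrite lerDl ltW // divr_gt0 // mulr_gt0.
have ths2 : (a + 2)%:R * r.+2%:R / rate * ln k%:R <= s%:R.
  apply: le_trans ths; rewrite ler_pM2r; last lra.
  by rewrite lerDr ltW // divr_gt0 // mulr_gt0.
(* As L <= (1 + d) L0 + 1, this amounts to r.+1 (d L0 + 1) <= eps L0. *)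
have mn : (r.+1 * L < n)%N.
  rewrite -(ltr_nat R) natrM; apply: le_lt_trans nL.
  have h : r.+1%:R <= eps / 2 * L0.
    have sL0 : s%:R <= L0 by apply: le_trans kL0; rewrite ler_nat.
    have : r.+1%:R / eps * 2 <= L0.
      apply: le_trans sL0; apply: le_trans ths1.
      have u0 : 0 <= r.+1%:R / eps by rewrite ltW // divr_gt0.
      rewrite -[4 * _ / _]mulrA; have := ler_wpM2l u0 lnk_ge.
      by move: (r.+1%:R / eps) (ln _) => u v; lra.
    rewrite mulrAC ler_pdivrMr //; lra.
  apply: (@le_trans _ _ (r.+1%:R * ((1 + d) * L0 + 1))).
    by rewrite ler_pM2l.
  have -> : r.+1%:R * ((1 + d) * L0 + 1) =
      r.+1%:R * L0 + eps / 2 * L0 + r.+1%:R.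
    rewrite /d; field; rewrite lt0r_neq0 //.
  lra.
pose m := (r.+1 * L).+1.
have m_le : m%:R <= k%:R ^+ (a + 2) :> R.
  apply: (@le_trans _ _ (r.+2%:R * L%:R)).
    by rewrite -natrM ler_nat /m [leqRHS]mulSn -add1n leq_add2r.
  apply: (@le_trans _ _ (r.+2%:R * (2 + d) * k%:R ^+ 2)).
    rewrite -mulrA ler_pM2l ?ltr0n //; apply: le_trans L_le _.
    have : 1 <= k%:R ^+ 2 :> R by rewrite exprn_ege1 ?ler1n.
    have d1 : 0 <= 1 + d by have := d_gt0; lra.
    by have := ler_wpM2l d1 L0k; lra.
  rewrite exprD ler_pM2r ?exprn_gt0 ?ltr0n //; apply: le_trans two_expn _.
  by apply: lerXn2r; rewrite ?nnegrE // ler_nat.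
have bin_le : 'C(m, r.+2)%:R <= expR (rate * s%:R) :> R.
  apply: (@le_trans _ _ (m%:R ^+ r.+2)).
    by rewrite -natrX ler_nat bin_le_expn.
  apply: (@le_trans _ _ ((k%:R ^+ (a + 2)) ^+ r.+2)).
    by apply: lerXn2r; rewrite ?nnegrE ?exprn_ge0.
  rewrite -exprM -[k%:R]lnK ?posrE ?ltr0n // -expRM_natl ler_expR natrM.
  move: ths2; rewrite mulrAC ler_pdivrMr //; lra.
have intersection_le : L%:R * (k%:R / L%:R) ^+ r.+2 <= s%:R / (1 + d) :> R.
  have L_gt0 : 0 < L%:R :> R by rewrite ltr0n.
  rewrite exprS mulrA mulrCA divff ?lt0r_neq0 // mulr1.
  rewrite expr_div_n mulrA -exprS ler_pdivrMr ?exprn_gt0 //.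
  have -> : k%:R ^+ r.+2 = s%:R * L0 ^+ r.+1.
    by rewrite critical_size_exp mulrC divfK // pnatr_eq0 -lt0n.
  have d1 : 0 < 1 + d by have := d_gt0; lra.
  rewrite -mulrA ler_pM2l ?ltr0n // mulrC ler_pdivlMr //.
  apply: (@le_trans _ _ (((1 + d) * L0) ^+ r.+1)).
    rewrite exprMn mulrC ler_pM2r ?exprn_gt0 // exprS ler_peMr //.
      by have := d_gt0; lra.
    by rewrite exprn_ege1 //; have := d_gt0; lra.
  by apply: lerXn2r; rewrite ?nnegrE // ltW.
have [||S [Sk Ss]] :=
  @exists_small_intersections R 'I_L 'I_m k r.+2 s x (ltW x_gt0).
- by rewrite card_ord.
- rewrite !card_ord; apply: (moment_bound x_gt0 d_gt0) => //.
by apply: (set_family_no_IT k0 sk Sk Ss); rewrite !card_ord.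
Qed.

End Threshold.

Theorem theorem1p10 (R : realType) (r : nat) (eps : R) :
  (2 <= r)%N -> 0 < eps ->
  exists C : R, 0 < C /\
    forall k s : nat, (0 < k)%N -> (0 < s)%N ->
      C * ln (k%:R : R) <= s%:R -> (s <= k)%N ->
      exists n : nat, is_f k r s n /\
        n%:R <= (r%:R - 1 + eps) *
                ((k%:R ^+ r / s%:R) `^ (r%:R - 1)^-1).
Proof.
case: r => [|[|r]] // _ eps0.
exists (threshold r eps); split; first exact: threshold_gt0.
move=> k s k0 s0 Cs sk.
apply: is_f_exists => // n; rewrite -/(critical_size R r.+2 k s).
have -> : r.+2%:R - 1 + eps = r.+1%:R + eps by rewrite -natr1; lra.
have [k1|k1] := ltnP 1 k.
  by apply: no_IT_above_critical_size; rewrite ?s0.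
(* For k = 1 the critical size is 1, so n > r.+1 + eps forces n >= r.+2. *)
have -> : k = 1%N by lia.
have -> : s = 1%N by lia.
rewrite critical_size1 mulr1 => rn; apply: no_IT_singletons.
by rewrite -(ltr_nat R); apply: lt_trans rn; rewrite ltrDl.
Qed.
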